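(* Let $d,k\ge1$ be integers and set $N:=(k+1)(d-1)$. There is a function $K=K(d,k,\cdot,\cdot)$ with the following property. Let $\ell\ge1$ and let $L_n$, $1\le n\le\ell$, be lower triangular linear automorphisms of $\mathbb{C}^d$, with vector of diagonal entries $(\lambda_n(1),\dots,\lambda_n(d))$. Then $$\left\|\mathscr{A}_{L_\ell\cdots L_1}\right\|_{L(\mathscr{H}^k/\mathscr{T}^k)}\le K\,\ell^{N}\,\max_{(n_r)}\ \prod_{r=0}^{N}\left(\Bigl(\max_{1\le h\le d}|\lambda_{n_{r+1},n_r}(h)|\Bigr)^{k-1}\max_{1\le i\le j\le d}\frac{|\lambda_{n_{r+1},n_r}(j)|}{|\lambda_{n_{r+1},n_r}(i)|}\right),$$ where $$K=K\Bigl(d,k,\max_{1\le n\le\ell}\|L_n\|,\max_{1\le n\le\ell}\|L_n^{-1}\|\Bigr),$$ and the first maximum is taken over all partitions $1=n_0\le n_1\le\dots\le n_N\le n_{N+1}=\ell$.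
   Context: $\mathbb{C}^d$ is endowed with the norm $|z|=\max_j|z_j|$, and $\|\cdot\|$ is the induced operator norm on linear endomorphisms. $\mathscr{H}^k$ is the space of homogeneous polynomial maps $p\colon\mathbb{C}^d\to\mathbb{C}^d$ of degree $k$, normed by $\|p\|=\sup_{z\ne0}|p(z)|/|z|^k$. $\mathscr{T}^k\subset\mathscr{H}^k$ is the subspace of strictly triangular maps, i.e. the span of the monomial maps $z^\alpha e_i$ with $|\alpha|=k$, $1\le i\le d$ and $\alpha_j=0$ for all $j\ge i$ ($e_1,\dots,e_d$ the canonical basis); equivalently, the $i$-th component depends only on $z_1,\dots,z_{i-1}$. For a linear automorphism $L$ of $\mathbb{C}^d$, the conjugacy operator $\mathscr{A}_L\colon\mathscr{H}^k\to\mathscr{H}^k$ is $\mathscr{A}_Lp=L^{-1}\,p\circ L$. If $L$ is lower triangular then $\mathscr{A}_L$ preserves $\mathscr{T}^k$, and the induced operator on $\mathscr{H}^k/\mathscr{T}^k$ is still denoted $\mathscr{A}_L$; $\|\cdot\|_{L(\mathscr{H}^k/\mathscr{T}^k)}$ is the operator norm with respect to the quotient norm. For $n\ge m$, $\lambda_{n,m}(j)=\prod_{q=m}^{n-1}\lambda_q(j)$, with $\lambda_{n,n}(j)=1$. *)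

(* Defs.v *)
From HB Require Import structures.
From mathcomp Require Import all_boot all_order all_algebra.
From mathcomp Require Import ring_quotient.
From mathcomp Require Import boolp classical_sets reals.
From mathcomp Require Import complex.
From mathcomp Require Import mpoly.

Set Implicit Arguments.
Unset Strict Implicit.
Unset Printing Implicit Defensive.

Import Order.TTheory GRing.Theory Num.Theory.
Import Normc.
Local Open Scope classical_set_scope.
Local Open Scope ring_scope.
Local Open Scope quotient_scope.

(* The space H^k. For k fixed, a polynomial map is the tuple of its components,
   and a point of C^d is a column vector. *)
Notation hmap R d k := {ffun 'I_d -> dhomog d R[i] k}.

Section Definitions.
Variables (R : realType) (d : nat).
Local Notation C := R[i].

Definition vnorm (z : 'cV[C]_d) : R := \big[Num.max/0]_(j < d) normc (z j 0).

(* The suprema below are over bounded nonempty sets when 0 < d (see the has_sup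
   lemmas at the end), so sup never takes its default value. *)
Definition mxnorm (A : 'M[C]_d) : R :=
  sup [set vnorm (A *m z) / vnorm z | z in [set z | z != 0]].

Variable k : nat.

Definition heval (p : hmap R d k) (z : 'cV[C]_d) : 'cV[C]_d :=
  \col_i (mpoly_of_dhomog (p i)).@[fun j => z j 0].

Definition hnorm (p : hmap R d k) : R :=
  sup [set vnorm (heval p z) / vnorm z ^+ k | z in [set z | z != 0]].

(* z^a e_i; indhomog makes it 0 when a does not have degree k. *)
Definition monomap (i : 'I_d) (a : 'X_{1..d}) : hmap R d k :=
  [ffun j => if j == i then indhomog k ('X_[a] : {mpoly C[d]}) else 0].

Definition tri_index (i : 'I_d) (a : 'X_{1..d}) : bool :=
  (mdeg a == k) && [forall j : 'I_d, (i <= j)%N ==> (a j == 0%N)].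

(* T^k, as the linear span of the monomial maps with triangular index; strict_triP
   below describes it through coefficients. *)
Definition strict_tri : pred (hmap R d k) := fun p =>
  `[< exists c : 'I_d -> 'X_{1..d} -> C,
      p = \sum_(i < d) \sum_(a : 'X_{1..d < k.+1} | tri_index i a)
            c i a *: monomap i a >].

Lemma strict_tri_submod_closed : submod_closed strict_tri.
Proof.
split=> [|b p q /asboolP[c ->] /asboolP[e ->]]; apply/asboolP.
  exists (fun _ _ => 0); rewrite big1 // => i _; rewrite big1 // => a _.
  by rewrite scale0r.
exists (fun i a => b * c i a + e i a).
rewrite scaler_sumr -big_split; apply: eq_bigr => i _ /=.
rewrite scaler_sumr -big_split; apply: eq_bigr => a _ /=.
by rewrite scalerDl scalerA.
Qed.

HB.instance Definition _ :=
  GRing.isSubmodClosed.Build C (hmap R d k) strict_tri strict_tri_submod_closed.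

(* H^k / T^k. *)
Definition hquot : Type := {ideal_quot (GRing.ZmodClosed.clone _ strict_tri _)}.

HB.instance Definition _ := GRing.Zmodule.on hquot.
HB.instance Definition _ := EqQuotient.on hquot.

Definition qnorm (x : hquot) : R := inf [set hnorm p | p in [set p | \pi_hquot p = x]].

Definition qopnorm (f : hquot -> hquot) : R :=
  sup [set qnorm (f x) | x in [set x | qnorm x <= 1]].

(* The components of L as linear forms, so that q \mPo linforms L is q o L. *)
Definition linforms (L : 'M[C]_d) : d.-tuple {mpoly C[d]} :=
  [tuple \sum_(h < d) L j h *: 'X_h | j < d].

Lemma conj_homog (L : 'M[C]_d) (p : hmap R d k) (i : 'I_d) :
  \sum_(j < d) invmx L i j *: (mpoly_of_dhomog (p j) \mPo linforms L) \is k.-homog.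
Proof.
apply: rpred_sum => j _; apply: rpredZ; rewrite comp_mpolyE.
rewrite big_seq; apply: rpred_sum => m mp; apply: rpredZ.
have <- : mdeg m = k by exact: (dhomog_mf (dhomog_is_dhomog (p j)) mp).
rewrite mdegE.
elim/big_ind2: _ => [|e1 q1 e2 q2|h _]; [exact: dhomog1|exact: dhomogM|].
rewrite tnth_mktuple -{2}[m h]mul1n; apply: dhomogMn; apply: rpred_sum => h' _.
by apply: rpredZ; rewrite dhomogX /= mdeg1.
Qed.

(* p |-> L^-1 p o L *)
Definition conj_op (L : 'M[C]_d) (p : hmap R d k) : hmap R d k :=
  [ffun i => DHomog (conj_homog L p i)].

(* The operator induced on H^k / T^k, through the canonical representative of a
   class; conj_quot_pi below shows that it is well defined for L lower triangular. *)
Definition conj_quot (L : 'M[C]_d) (x : hquot) : hquot :=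
  \pi_hquot (conj_op L (repr x)).

End Definitions.

(* lambda_{n,m}(j), for the diagonal entries lambda_q(j) of L_q. *)
Definition lam (R : realType) (d : nat) (L : nat -> 'M[R[i]]_d) (n m : nat) (j : 'I_d) : R[i] :=
  \prod_(m <= q < n) L q j j.

(* max_h |mu(h)|, and max_{i <= j} |mu(j)| / |mu(i)|, for mu in C^d *)
Definition maxabs (R : realType) (d : nat) (mu : 'I_d -> R[i]) : R :=
  \big[Num.max/0]_(h < d) normc (mu h).

Definition maxratio (R : realType) (d : nat) (mu : 'I_d -> R[i]) : R :=
  \big[Num.max/0]_(i < d) \big[Num.max/0]_(j < d | (i <= j)%N) (normc (mu j) / normc (mu i)).

(* 1 = n_0 <= n_1 <= ... <= n_N <= n_{N+1} = l *)
Definition is_partition (N l : nat) (n : {ffun 'I_N.+2 -> 'I_l.+1}) : bool :=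
  [&& n ord0 == 1%N :> nat, n ord_max == l :> nat
    & [forall r : 'I_N.+1, (n (inord r) <= n (inord r.+1))%N]].

Section Facts.
Variables (R : realType) (d : nat).
Local Notation C := R[i].

Lemma normc_ge0 (x : C) : 0 <= normc x.
Proof. by case: x => a b; exact: sqrtr_ge0. Qed.

Lemma normc_sum (I : Type) (r : seq I) (P : pred I) (F : I -> C) :
  normc (\sum_(i <- r | P i) F i) <= \sum_(i <- r | P i) normc (F i).
Proof.
elim/big_ind2: _ => [|x1 y1 x2 y2 h1 h2|//]; first by rewrite normc0.
exact: le_trans (le_normcD _ _) (lerD h1 h2).
Qed.

Lemma normc_prod (I : Type) (r : seq I) (P : pred I) (F : I -> C) :
  normc (\prod_(i <- r | P i) F i) = \prod_(i <- r | P i) normc (F i).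
Proof. by elim/big_rec2: _ => [|i x y _ <-]; rewrite ?normc1 ?normcM. Qed.

Lemma normcX (x : C) n : normc (x ^+ n) = normc x ^+ n.
Proof. by elim: n => [|n IH]; rewrite ?normc1 // !exprS normcM IH. Qed.

Lemma sup_ge0 (E : set R) : (forall x, E x -> 0 <= x) -> 0 <= sup E.
Proof.
move=> E0; have [[[y Ey] ub]|nE] := pselect (has_sup E); last by rewrite sup_out.
by apply: le_trans (E0 _ Ey) _; apply: ub_le_sup.
Qed.

Lemma vnorm_ge0 (z : 'cV[C]_d) : 0 <= vnorm z.
Proof. exact: bigmax_ge_id. Qed.

Lemma le_vnorm (z : 'cV[C]_d) j : normc (z j 0) <= vnorm z.
Proof. exact: le_bigmax. Qed.

Lemma vnorm_le (z : 'cV[C]_d) (B : R) :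
  0 <= B -> (forall j, normc (z j 0) <= B) -> vnorm z <= B.
Proof. by move=> B0 h; apply: bigmax_le => // j _; exact: h. Qed.

Lemma vnorm_gt0 (z : 'cV[C]_d) : z != 0 -> 0 < vnorm z.
Proof.
move=> z0; rewrite lt_neqAle vnorm_ge0 andbT eq_sym; apply: contra z0 => /eqP v0.
apply/eqP/colP => j; rewrite mxE; apply: eq0_normc; apply/eqP.
by rewrite eq_le normc_ge0 -v0 le_vnorm.
Qed.

Lemma vnorm0 : vnorm (0 : 'cV[C]_d) = 0.
Proof.
by apply/eqP; rewrite eq_le vnorm_ge0 vnorm_le // => j; rewrite mxE normc0.
Qed.

Lemma nonzero_vector : (0 < d)%N -> (const_mx 1 : 'cV[C]_d) != 0.
Proof.
move=> hd; apply/eqP => /colP/(_ (Ordinal hd)); rewrite !mxE => /eqP.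
by rewrite oner_eq0.
Qed.

Lemma mxnorm_has_sup (A : 'M[C]_d) : (0 < d)%N ->
  has_sup [set vnorm (A *m z) / vnorm z | z in [set z | z != 0]].
Proof.
move=> hd; split; first by eexists; exists (const_mx 1) => //; exact: nonzero_vector.
exists (\sum_i \sum_j normc (A i j)) => _ [z z0 <-].
rewrite ler_pdivrMr ?vnorm_gt0 //.
have S0 i : 0 <= \sum_j normc (A i j) by apply: sumr_ge0 => j _; exact: normc_ge0.
apply: vnorm_le => [|i].
  by apply: mulr_ge0 (vnorm_ge0 _); apply: sumr_ge0 => i _.
rewrite mxE; apply: le_trans (normc_sum _ _ _) _.
apply: (@le_trans _ _ ((\sum_j normc (A i j)) * vnorm z)).
  rewrite mulr_suml; apply: ler_sum => j _; rewrite normcM.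
  by apply: ler_wpM2l; rewrite ?normc_ge0 ?le_vnorm.
apply: ler_wpM2r; first exact: vnorm_ge0.
by rewrite [leRHS](bigD1 i) //= lerDl; apply: sumr_ge0 => i' _.
Qed.

Lemma mxnormP (A : 'M[C]_d) z : vnorm (A *m z) <= mxnorm A * vnorm z.
Proof.
have [->|z0] := eqVneq z 0; first by rewrite mulmx0 vnorm0 mulr0.
have hd : (0 < d)%N.
  by move: z z0; case: (d) => // z; rewrite (flatmx0 z) eqxx.
rewrite -ler_pdivrMr ?vnorm_gt0 //; apply: ub_le_sup; last by exists z.
by case: (mxnorm_has_sup A hd).
Qed.

Lemma mxnorm_ge0 (A : 'M[C]_d) : 0 <= mxnorm A.
Proof. by apply: sup_ge0 => // _ [z _ <-]; rewrite divr_ge0 ?vnorm_ge0. Qed.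

Section Degree.
Variable k : nat.
Implicit Types p : hmap R d k.

Lemma mcoeff_homog0 p i m : mdeg m != k -> (mpoly_of_dhomog (p i))@_m = 0.
Proof. exact: (dhomog_nemf_coeff (dhomog_is_dhomog (p i))). Qed.

Lemma hnorm_has_sup p : (0 < d)%N ->
  has_sup [set vnorm (heval p z) / vnorm z ^+ k | z in [set z | z != 0]].
Proof.
move=> hd; split; first by eexists; exists (const_mx 1) => //; exact: nonzero_vector.
pose S i := \sum_(m <- msupp (mpoly_of_dhomog (p i))) normc (mpoly_of_dhomog (p i))@_m.
have S0 i : 0 <= S i by apply: sumr_ge0 => m _; exact: normc_ge0.
exists (\sum_i S i) => _ [z z0 <-].
rewrite ler_pdivrMr ?exprn_gt0 ?vnorm_gt0 //.
apply: vnorm_le => [|i].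
  by apply: mulr_ge0; rewrite ?exprn_ge0 ?vnorm_ge0 //; apply: sumr_ge0.
apply: (@le_trans _ _ (S i * vnorm z ^+ k)); last first.
  apply: ler_wpM2r; first by rewrite exprn_ge0 ?vnorm_ge0.
  by rewrite [leRHS](bigD1 i) //= lerDl; apply: sumr_ge0.
rewrite mxE mevalE; apply: le_trans (normc_sum _ _ _) _.
rewrite mulr_suml big_seq [leRHS]big_seq; apply: ler_sum => m mp.
rewrite normcM; apply: ler_wpM2l; first exact: normc_ge0.
have <- : mdeg m = k by exact: (dhomog_mf (dhomog_is_dhomog (p i)) mp).
rewrite normc_prod mdegE -prodrXr; apply: ler_prod => j _.
by rewrite normcX exprn_ge0 ?normc_ge0 //= lerXn2r ?nnegrE ?normc_ge0 ?vnorm_ge0 ?le_vnorm.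
Qed.

Lemma hnormP p z : z != 0 -> vnorm (heval p z) <= hnorm p * vnorm z ^+ k.
Proof.
move=> z0; have hd : (0 < d)%N.
  by move: z z0; case: (d) => // z; rewrite (flatmx0 z) eqxx.
rewrite -ler_pdivrMr ?exprn_gt0 ?vnorm_gt0 //; apply: ub_le_sup; last by exists z.
by case: (hnorm_has_sup p hd).
Qed.

Lemma hnorm_ge0 p : 0 <= hnorm p.
Proof.
by apply: sup_ge0 => // _ [z _ <-]; rewrite divr_ge0 ?exprn_ge0 ?vnorm_ge0.
Qed.

Lemma heval_conj (L : 'M[C]_d) p z :
  heval (conj_op L p) z = invmx L *m heval p (L *m z).
Proof.
apply/colP => i; rewrite !mxE ffunE /= raddf_sum /=; apply: eq_bigr => j _.
rewrite mevalZ comp_mpoly_meval mxE; congr (_ * _); apply: meval_eq => h.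
rewrite tnth_mktuple raddf_sum mxE /=; apply: eq_bigr => h' _.
by rewrite mevalZ mevalXU.
Qed.

Lemma hnorm_conj (L : 'M[C]_d) p : (0 < d)%N -> L \in unitmx ->
  hnorm (conj_op L p) <= mxnorm (invmx L) * mxnorm L ^+ k * hnorm p.
Proof.
move=> hd uL; apply: ge_sup => [|_ [z z0 <-]].
  by case: (hnorm_has_sup (conj_op L p) hd).
rewrite ler_pdivrMr ?exprn_gt0 ?vnorm_gt0 // heval_conj.
have Lz0 : L *m z != 0.
  by apply: contra z0 => /eqP Lz; rewrite -(mulKmx uL z) Lz mulmx0.
apply: le_trans (mxnormP _ _) _; rewrite -!mulrA.
apply: ler_wpM2l; first exact: mxnorm_ge0.
apply: le_trans (hnormP _ Lz0) _; rewrite mulrCA.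
apply: ler_wpM2l; first exact: hnorm_ge0.
rewrite -exprMn lerXn2r ?nnegrE ?mulr_ge0 ?vnorm_ge0 ?mxnorm_ge0 //.
exact: mxnormP.
Qed.

Lemma mcoeff_monomap (i j : 'I_d) (a m : 'X_{1..d}) : mdeg a = k ->
  (mpoly_of_dhomog (monomap R k i a j))@_m = ((j == i) && (a == m))%:R.
Proof.
move=> ha; rewrite ffunE; case: eqP => _; last by rewrite mcoeff0.
by rewrite /indhomog -[mpoly_of_dhomog _]/(val _) insubdK ?mcoeffX // -topredE /= dhomogX /= ha.
Qed.

Lemma mcoeff_span (c : 'I_d -> 'X_{1..d} -> C) j m :
  (mpoly_of_dhomog ((\sum_(i < d) \sum_(a : 'X_{1..d < k.+1} | tri_index k i a)
     c i a *: monomap R k i a) j))@_m = if tri_index k j m then c j m else 0.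
Proof.
pose f p := (mpoly_of_dhomog (p j))@_m.
have f0 : f 0 = 0 by rewrite /f ffunE mcoeff0.
have fD : {morph f : p q / p + q} by move=> p q; rewrite /f ffunE /= mcoeffD.
rewrite -/(f _) (big_morph f fD f0).
have fm i (a : 'X_{1..d < k.+1}) : tri_index k i a ->
    f (c i a *: monomap R k i a) = if (i == j) && (bmnm a == m) then c i a else 0.
  move=> /andP[/eqP ha _]; rewrite /f ffunE /= mcoeffZ mcoeff_monomap // eq_sym.
  by case: ifP => _; rewrite ?mulr1 ?mulr0.
rewrite (bigD1 j) //= [X in _ + X]big1 ?addr0 => [|i /negbTE ij]; last first.
  by rewrite (big_morph f fD f0) big1 // => a ha; rewrite fm // ij.
rewrite (big_morph f fD f0); under eq_bigr => a ha do rewrite fm // eqxx /=.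
case: ifPn => tm; last first.
  by rewrite big1 // => a ta; case: eqP => // e; rewrite -e ta in tm.
have hm : (mdeg m < k.+1)%N by case/andP: tm => /eqP ->.
rewrite (bigD1 (BMultinom hm)) //= eqxx big1 ?addr0 // => a /andP[_ am].
by case: eqP => // e; case/eqP: am; apply: val_inj.
Qed.

Lemma strict_triP p :
  reflect (forall (i j : 'I_d) m, (i <= j)%N ->
             (mpoly_of_dhomog (p i))@_m != 0 -> m j = 0%N)
          (p \in strict_tri (R:=R) (d:=d) (k:=k)).
Proof.
apply: (iffP idP) => [/asboolP[c ->] i j m leij|hp].
  rewrite mcoeff_span; case: ifP => [/andP[_ /forallP/(_ j)]|_]; last by rewrite eqxx.
  by rewrite leij => /eqP.
apply/asboolP; exists (fun i a => (mpoly_of_dhomog (p i))@_a).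
apply/ffunP => i; apply: val_inj; apply/mpolyP => m.
rewrite [RHS](mcoeff_span (fun i a => (mpoly_of_dhomog (p i))@_a)).
case: ifPn => // tm; apply: contraNeq tm => cm; apply/andP; split.
  by apply: contraNT cm => /mcoeff_homog0 ->.
by apply/forallP => j; apply/implyP => leij; apply/eqP; apply: hp cm.
Qed.

Lemma invmx_trig (L : 'M[C]_d) : L \in unitmx -> is_trig_mx L -> is_trig_mx (invmx L).
Proof.
move=> uL tL; have Lz (i j : 'I_d) : (i < j)%N -> L i j = 0 by move/is_trig_mxP: tL; apply.
have diag0 j : L j j != 0.
  move: uL; rewrite unitmxE det_trig // unitfE; apply: contra => /eqP Lj.
  by rewrite (bigD1 j) //= Lj mul0r.
apply/is_trig_mxP => i j; have [n] := ubnP (d - j).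
elim: n j => // n IH j hn ij.
have /matrixP/(_ i j) := mulVmx uL.
rewrite !mxE -val_eqE ltn_eqF //= (bigD1 j) //= big1 ?addr0 => [|h hj].
  by move/eqP; rewrite mulf_eq0 (negbTE (diag0 j)) orbF => /eqP.
have [lthj|lejh] := ltnP h j; first by rewrite (Lz h j) ?mulr0.
have ltjh : (j < h)%N by rewrite ltn_neqAle lejh eq_sym -val_eqE in hj *; rewrite hj.
rewrite IH ?mul0r //; last exact: ltn_trans ltjh.
by apply: leq_trans (ltn_sub2l (ltn_ord j) ltjh) _; rewrite -ltnS.
Qed.

Definition mexp (j : 'I_d) (m : 'X_{1..d}) : nat := m j.
Lemma mexp0 j : mexp j 0%MM = 0%N. Proof. by rewrite /mexp mnm0E. Qed.
Lemma mexpD j : {morph mexp j : m1 m2 / (m1 + m2)%MM >-> (m1 + m2)%N}.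
Proof. by move=> m1 m2; rewrite /mexp mnmDE. Qed.
HB.instance Definition _ j := isMeasure.Build d (mexp j) (mexp0 j) (mexpD j).

Lemma conj_strict_tri (L : 'M[C]_d) p : L \in unitmx -> is_trig_mx L ->
  p \in strict_tri (R:=R) (d:=d) (k:=k) -> conj_op L p \in strict_tri (R:=R) (d:=d) (k:=k).
Proof.
move=> uL tL /strict_triP hp; apply/strict_triP => i j m leij.
have tM := invmx_trig uL tL.
suff hom : mpoly_of_dhomog (conj_op L p i) \is 0.-homog for (mexp j).
  by rewrite -mcoeff_msupp => mi; exact: (dhomog_mf hom mi).
rewrite ffunE /=; apply: rpred_sum => h _.
have [ltih|lehi] := ltnP i h.
  by move/is_trig_mxP: tM => ->; rewrite // scale0r rpred0.
apply: rpredZ; rewrite comp_mpolyE big_seq; apply: rpred_sum => a ap.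
apply: rpredZ; elim/big_ind: _ => [|q1 q2 h1 h2|j' _]; first exact: dhomog1.
  by rewrite -[0%N]addn0; apply: dhomogM.
have [lehj'|ltj'h] := leqP h j'.
  by rewrite (hp h j' a) -?mcoeff_msupp // expr0; exact: dhomog1.
rewrite -[0%N](mul0n (a j')); apply: dhomogMn; rewrite tnth_mktuple.
apply: rpred_sum => h' _; have [e|ne] := eqVneq h' j.
  move/is_trig_mxP: tL => ->; first by rewrite scale0r rpred0.
  by rewrite e; apply: leq_trans ltj'h (leq_trans lehi leij).
by apply: rpredZ; rewrite dhomogX /= /mexp mnm1E (negbTE ne).
Qed.

Lemma conj_opB (L : 'M[C]_d) : {morph conj_op L : p q / p - q :> hmap R d k}.
Proof.
move=> p q; apply/ffunP => i; apply: val_inj; rewrite !ffunE /= -sumrB.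
apply: eq_bigr => j _; rewrite -scalerBr; congr (_ *: _).
by rewrite !ffunE /= -comp_mpolyB.
Qed.

Lemma conj_quot_pi (L : 'M[C]_d) p : L \in unitmx -> is_trig_mx L ->
  conj_quot L (\pi_(hquot R d k) p) = \pi_(hquot R d k) (conj_op L p).
Proof.
move=> uL tL; apply/eqP; rewrite /conj_quot.
rewrite -[_ == _]/(\pi_(hquot R d k) _ == \pi _).
rewrite -Quotient.idealrBE -conj_opB conj_strict_tri //.
by rewrite Quotient.idealrBE reprK.
Qed.

Lemma qnorm_has_inf (x : hquot R d k) :
  has_inf [set hnorm p | p in [set p | \pi_(hquot R d k) p = x]].
Proof.
split; first by exists (hnorm (repr x)), (repr x) => //=; rewrite reprK.
by exists 0 => _ [p _ <-]; exact: hnorm_ge0.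
Qed.

Lemma qopnorm_has_sup (L : 'M[C]_d) : (0 < d)%N -> L \in unitmx -> is_trig_mx L ->
  has_sup [set qnorm (conj_quot L x) | x in [set x : hquot R d k | qnorm x <= 1]].
Proof.
move=> hd uL tL; split.
  exists (qnorm (conj_quot L (0 : hquot R d k))), 0 => //=.
  apply: le_trans (_ : hnorm (0 : hmap R d k) <= 1).
    apply: ge_inf; first by case: (qnorm_has_inf (0 : hquot R d k)).
    by exists 0 => //=; rewrite raddf0.
  apply: ge_sup => [|_ [z z0 <-]]; first by case: (hnorm_has_sup (0 : hmap R d k) hd).
  suff -> : heval (0 : hmap R d k) z = 0 by rewrite vnorm0 mul0r.
  by apply/colP => i; rewrite !mxE ffunE /= meval0.
pose B := mxnorm (invmx L) * mxnorm L ^+ k.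
have B0 : 0 <= B by rewrite mulr_ge0 ?exprn_ge0 ?mxnorm_ge0.
exists (B * 2) => _ [x /= x1 <-].
have [_ [p px <-] hp] := inf_adherent ltr01 (qnorm_has_inf x).
apply: (@le_trans _ _ (hnorm (conj_op L p))).
  apply: ge_inf; first by case: (qnorm_has_inf (conj_quot L x)).
  by exists (conj_op L p) => //=; rewrite -conj_quot_pi // px.
apply: le_trans (hnorm_conj p hd uL) _; rewrite ler_wpM2l //.
apply: ltW (lt_le_trans hp _); rewrite -[2]/(1 + 1).
exact: lerD.
Qed.

End Degree.
End Facts.

(* Main.v *)
Require Import Defs.
From mathcomp Require Import all_boot all_order all_algebra.
From mathcomp Require Import boolp classical_sets reals complex mpoly ring.
Import Order.TTheory GRing.Theory Num.Theory Normc.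
Local Open Scope ring_scope.

Set Implicit Arguments.
Unset Strict Implicit.

(** Expand a homogeneous map as a combination of the maps
    z_(w_1) ... z_(w_k) e_i, indexed by states (i, w), with i an index and w a
    word of k indices. Conjugation by L acts on the coefficients by a matrix with
    entries (L^-1)_(i i') prod_t L_(w'_t w_t) (conj_entry, conj_of_coef). When L
    is lower triangular, a nonzero entry forces i' <= i and w_t <= w'_t: the
    matrix is triangular for the height i + sum_t (d-1 - w_t), and from a
    nontriangular state it leads to nontriangular states only (conj_entry_down).
    Only those states matter in the quotient (qnorm_of_coef).

    A coefficient of the conjugate by L_l ... L_1 is thus a sum over paths
    of states. The height, an integer between 0 and N = (k+1)(d-1), drops
    whenever the state changes, so a path makes at most N jumps, and there are
    at most a constant times l^N paths. Between two jumps the path stays in a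
    nontriangular state (i, w) and collects a product of diagonal entries
    prod_t lambda(w_t) / lambda(i); one of the w_t is at least i, which yields the
    factor maxabs^(k-1) * maxratio of the theorem (prod_diag_le). At a jump the
    entry is replaced by the diagonal one at the same time, at the cost of a
    constant depending on the norms of L and L^-1 (conj_entry_diag_ge). The count
    of paths is path_bound, an abstract statement on nonnegative matrices.

    What remains is to compare norms: hnorm is at most the sum of the
    moduli of the coefficients (hnorm_of_coef), and conversely bounds every
    coefficient up to a constant depending on d and k (cauchy_estimate). *)

(** * Products of triangular nonnegative matrices *)

(** The weight of a path of states is the product of the entries b t s s' along
    its steps; V m s is at most T times the total weight of the paths that start
    from s at time m and end at time l. Phi n m bounds the weight of a stay in one state during
    the times m, ..., n - 1. *)
Section Paths.
Variables (R : realType) (S : finType) (b : nat -> S -> S -> R) (V : nat -> S -> R).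
Variables (good : pred S) (g : S -> nat) (Phi : nat -> nat -> R).
Variables (l : nat) (C T : R).
Hypothesis b_ge0 : forall m s s', 0 <= b m s s'.
Hypothesis V_ge0 : forall m s, 0 <= V m s.
Hypothesis V_step : forall m s, (0 < m < l)%N -> good s ->
  V m s <= \sum_s' b m s s' * V m.+1 s'.
Hypothesis V_end : forall s, good s -> V l s <= T.
Hypothesis b_down : forall m s s', (0 < m < l)%N -> good s -> b m s s' != 0 ->
  s' != s -> good s' && (g s' < g s)%N.
Hypothesis b_diag : forall m s s', (0 < m < l)%N -> good s -> b m s s' <= C * b m s s.
Hypothesis PhiP : forall m n s, (0 < m)%N -> (m <= n <= l)%N -> good s ->
  \prod_(m <= q < n) b q s s <= Phi n m.
Hypothesis (C0 : 0 <= C) (T0 : 0 <= T).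

Let D s m n := \prod_(m <= q < n) b q s s.

Let D_ge0 s m n : 0 <= D s m n.
Proof. by apply: prodr_ge0. Qed.

(** Obtained by expanding the term s' = s of V_step again and again: t is
    the time of the first jump out of s, and the first summand is the path that
    never jumps. *)
Lemma unroll_stays m s : (0 < m <= l)%N -> good s ->
  V m s <= D s m l * T
    + \sum_(m <= t < l) D s m t * \sum_(s' | s' != s) b t s s' * V t.+1 s'.
Proof.
move=> /andP[m0 ml] gs.
have [n ln] : exists n, l = (m + n)%N by exists (l - m)%N; rewrite subnKC.
elim: n m m0 ml ln => [|n IH] m m0 ml ln.
  by rewrite ln addn0 /D !big_geq // addr0 mul1r -[m in V m s]addn0 -ln V_end.
have lml : (m < l)%N by rewrite ln addnS ltnS leq_addr.
apply: le_trans (V_step _ gs) _; first by rewrite m0.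
rewrite (bigD1 s) //= big_ltn // {2}/D big_geq // mul1r addrCA [leLHS]addrC.
rewrite lerD2l; apply: le_trans (ler_wpM2l (b_ge0 _ _ _) (IH m.+1 isT lml _)) _.
  by rewrite ln addnS.
rewrite mulrDr mulrA /D [in leRHS]big_ltn // lerD2l mulr_sumr.
apply: ler_sum_nat => t /andP[mt tl].
by rewrite [in leRHS]big_ltn // mulrA.
Qed.

(** A path of states jumps at most g s times, since g drops at each jump. The
    induction follows the first jump, at time t out of s: its weight is at most
    C times the weight of staying, so the stay in s may be prolonged through
    time t and bounded by Phi t.+1 m. The factor P carries the product of the
    stays already made, which lets the hypothesis range over the chains
    from m to l only and keeps B fixed throughout. Each level costs a factor
    (1 + C * #|S|) * l, for the jump not made or for its time and target. *)
Lemma path_bound a m s P B : good s -> (g s <= a)%N -> (0 < m <= l)%N -> 0 <= P ->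
  (forall n : nat -> nat, n 0%N = m -> n a.+1 = l ->
     (forall r, (r <= a)%N -> (n r <= n r.+1)%N) ->
     P * \prod_(r < a.+1) Phi (n r.+1) (n r) <= B) ->
  P * V m s <= T * (((1 + C * #|S|%:R) * l%:R) ^+ a * B).
Proof.
elim: a m s P => [|a IH] m s P gs ga m0l P0 hB.
  rewrite expr0 mul1r; have m0 : (0 < m)%N by case/andP: m0l.
  apply: le_trans (ler_wpM2l P0 (unroll_stays m0l gs)) _.
  rewrite [X in _ + X]big_nat_cond [X in _ + X]big1 => [|t]; last first.
    rewrite andbT => /andP[mt tl]; rewrite big1 ?mulr0 // => s' ne.
    have [->|nz] := eqVneq (b t s s') 0; first by rewrite mul0r.
    have t0 : (0 < t < l)%N by rewrite (leq_trans m0 mt).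
    have /andP[_] := b_down t0 gs nz ne.
    by move/leq_trans/(_ ga); rewrite ltn0.
  rewrite addr0 mulrA mulrC ler_wpM2l //.
  have := hB (fun r => if r is 0 then m else l) erefl erefl.
  rewrite big_ord_recl big_ord0 mulr1 /=; move=> hB1.
  apply: le_trans (ler_wpM2l P0 _) (hB1 _).
    by apply: PhiP; rewrite // leqnn; case/andP: m0l => _ ->.
  by case=> //= _; case/andP: m0l.
have /andP[m0 ml] := m0l.
have l1 : 1 <= l%:R :> R by rewrite ler1n (leq_trans m0 ml).
set K := (1 + C * #|S|%:R) * l%:R.
have hK : 1 <= K.
  by rewrite mulr_ege1 // lerDl mulr_ge0.
have PhiD n n' : (0 < n)%N -> (n <= n' <= l)%N -> 0 <= Phi n' n /\ D s n n' <= Phi n' n.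
  move=> n0 nn; have h := PhiP n0 nn gs; split => //.
  by apply: le_trans h; exact: D_ge0.
(* The path without a jump is compared with the chain m, l, ..., l, whose
   trailing factors Phi l l are at least an empty product. *)
have B1 : P * D s m l <= B.
  have := hB (fun r => if r is 0 then m else l) erefl erefl.
  rewrite big_ord_recl /= => h; apply: le_trans (h _); last by case.
  apply: ler_wpM2l => //.
  have [P1 P2] : 0 <= Phi l m /\ D s m l <= Phi l m.
    by apply: PhiD; rewrite // leqnn ml.
  apply: le_trans P2 _; rewrite ler_peMr //.
  elim/big_rec: _ => [//|r x _ x1]; rewrite mulr_ege1 //.
  have [_] : 0 <= Phi l l /\ D s l l <= Phi l l.
    by apply: PhiD; rewrite ?leqnn // (leq_trans m0 ml).
  by rewrite /D big_geq.
have B0 : 0 <= B by apply: le_trans B1; rewrite mulr_ge0 ?D_ge0.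
have term t : (m <= t < l)%N ->
    P * (D s m t * \sum_(s' | s' != s) b t s s' * V t.+1 s')
      <= C * #|S|%:R * (T * (K ^+ a * B)).
  move=> /andP[mt tl]; have t0 : (0 < t < l)%N by rewrite (leq_trans m0 mt).
  have ptl : (m <= t.+1 <= l)%N by rewrite tl (leq_trans mt).
  have [F1 F2] := PhiD m t.+1 m0 ptl.
  rewrite [leLHS]mulrA mulr_sumr.
  apply: (@le_trans _ _ (\sum_(s' : S) C * (T * (K ^+ a * B)))); last first.
    rewrite sumr_const (_ : #|_| = #|S|); last exact: eq_card.
    by rewrite -[leLHS]mulr_natr mulrAC.
  rewrite big_mkcond; apply: ler_sum => s' _; case: ifP => [ne|_]; last first.
    by rewrite !mulr_ge0 // exprn_ge0 // (le_trans ler01).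
  have [->|nz] := eqVneq (b t s s') 0.
    by rewrite mul0r mulr0 !mulr_ge0 // exprn_ge0 // (le_trans ler01).
  have /andP[gs' gg] := b_down t0 gs nz ne.
  apply: (@le_trans _ _ (C * (P * Phi t.+1 m * V t.+1 s'))).
    apply: (@le_trans _ _ (P * D s m t * (C * b t s s * V t.+1 s'))).
      by rewrite ler_wpM2l ?mulr_ge0 ?D_ge0 // ler_wpM2r // b_diag.
    have -> : P * D s m t * (C * b t s s * V t.+1 s') = C * (P * D s m t.+1 * V t.+1 s').
      by rewrite /D [in RHS]big_nat_recr //=; ring.
    by rewrite ler_wpM2l // ler_wpM2r // ler_wpM2l.
  rewrite ler_wpM2l //; apply: IH => //; rewrite ?mulr_ge0 //.
    by rewrite -ltnS (leq_trans gg).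
  move=> n n0 nl nm; rewrite -mulrA.
  have := hB (fun r => if r is r'.+1 then n r' else m) erefl nl.
  rewrite big_ord_recl /= n0; apply; case=> [_|r]; last exact: nm.
  by rewrite n0 ltnW.
apply: le_trans (ler_wpM2l P0 (unroll_stays m0l gs)) _.
rewrite mulrDr mulr_sumr.
have -> : T * (K ^+ a.+1 * B)
    = l%:R * (T * (K ^+ a * B)) + l%:R * (C * #|S|%:R * (T * (K ^+ a * B))).
  by rewrite exprS {1}/K; ring.
apply: lerD.
  rewrite [leLHS]mulrA [leLHS]mulrC [leRHS]mulrCA ler_wpM2l // [leRHS]mulrA.
  apply: le_trans B1 _; rewrite ler_peMl // mulr_ege1 //.
  by rewrite exprn_ege1.
apply: (@le_trans _ _ (\sum_(m <= t < l) (C * #|S|%:R * (T * (K ^+ a * B))))).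
  exact: ler_sum_nat.
rewrite sumr_const_nat -[leLHS]mulr_natl ler_wpM2r ?ler_nat ?leq_subr //.
by rewrite !mulr_ge0 // exprn_ge0 // (le_trans ler01).
Qed.
End Paths.

(** * Coefficients of homogeneous maps *)

Lemma digits_inj b d (f g : 'I_d -> nat) :
  (forall i, f i < b)%N -> (forall i, g i < b)%N ->
  (\sum_i f i * b ^ i = \sum_i g i * b ^ i)%N -> f =1 g.
Proof.
elim: d f g => [|d IH] f g fb gb; first by move=> _ [].
have shift (h : 'I_d.+1 -> nat) :
    (\sum_i h i * b ^ i = (\sum_(i < d) h (lift ord0 i) * b ^ i) * b + h ord0)%N.
  rewrite big_ord_recl expn0 muln1 addnC big_distrl; congr (_ + _)%N.
  by apply: eq_bigr => i _; rewrite /= expnSr mulnA.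
rewrite !shift => e; have b0 : (0 < b)%N by exact: leq_ltn_trans (fb ord0).
have e0 : f ord0 = g ord0.
  by have := congr1 (modn^~ b) e; rewrite !modnMDl !modn_small.
move=> i; case: (unliftP ord0 i) => [j|] -> //.
apply: (IH (f \o lift ord0) (g \o lift ord0)) => [{}i|{}i|].
- exact: fb.
- exact: gb.
- by have := congr1 (divn^~ b) e; rewrite !divnMDl // !divn_small ?addn0.
Qed.

Section Words.
Variables (R : realType) (d k : nat).
Local Notation C := R[i].
Local Notation word := {ffun 'I_k -> 'I_d}.
Local Notation state := ('I_d * word)%type.

Definition word_mon (w : word) : 'X_{1..d} := (\sum_t U_(w t))%MM.

Lemma mdeg_word_mon w : mdeg (word_mon w) = k.
Proof.
by rewrite mdeg_sum (eq_bigr (fun=> 1%N)) => [|t _]; rewrite ?mdeg1 // sum1_card card_ord.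
Qed.

Lemma word_mon_onto (m : 'X_{1..d}) : mdeg m = k -> exists w, word_mon w = m.
Proof.
move=> mk; have sz : size (m2s m) == k by rewrite size_m2s mk.
have [T mT] : exists T : k.-tuple 'I_d, tval T = m2s m by exists (Tuple sz).
exists [ffun t => tnth T t]; rewrite -[RHS]s2mK -mT; apply/mnmP => j.
rewrite mnm_sumE mnmE -sum1_count big_tuple [RHS]big_mkcond.
by apply: eq_bigr => t _; rewrite ffunE mnm1E /=; case: eqP.
Qed.

Lemma sum_state (G : nmodType) (F : state -> G) : \sum_s F s = \sum_i \sum_w F (i, w).
Proof.
by rewrite (pair_bigA _ (fun i w => F (i, w))); apply: eq_bigr => -[].
Qed.

Lemma sum_state_at i (F : word -> C) :
  \sum_(s : state) (if s.1 == i then F s.2 else 0) = \sum_w F w.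
Proof.
rewrite sum_state (bigD1 i) //= eqxx.
by rewrite [X in _ + X]big1 ?addr0 // => j /negbTE ->; rewrite big1.
Qed.

(** The redundant expansion over words: a monomial is listed once for each
    ordering of its factors. Words, unlike multi-indices, make the matrix of a
    conjugation a plain product of entries (conj_entry). *)
Definition of_coef (c : state -> C) : hmap R d k :=
  \sum_s c s *: monomap R k s.1 (word_mon s.2).

Lemma heval_of_coef c z i :
  heval (of_coef c) z i 0 = \sum_(w : word) c (i, w) * \prod_t z (w t) 0.
Proof.
pose f (p : hmap R d k) := heval p z i 0.
have f0 : f 0 = 0 by rewrite /f mxE ffunE meval0.
have fD : {morph f : p q / p + q} by move=> p q; rewrite /f !mxE ffunE /= mevalD.
rewrite -/(f _) (big_morph f fD f0).
rewrite -(sum_state_at i (fun w => c (i, w) * \prod_t z (w t) 0)); apply: eq_bigr.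
move=> [j w] _ /=; rewrite /f mxE !ffunE /= eq_sym.
case: eqP => [->|_]; last by rewrite /= scaler0 meval0.
rewrite mevalZ /indhomog -[mpoly_of_dhomog _]/(val _) insubdK; last first.
  by rewrite -topredE /= dhomogX /= mdeg_word_mon.
rewrite /word_mon -mprodXE rmorph_prod; congr (_ * _).
by apply: eq_bigr => t _; rewrite /= mevalXU.
Qed.

(** Along the curve z_j = x^((k+1)^j) the monomials of degree k become distinct
    powers of x, by uniqueness of base k+1 digits, so that a coefficient is read
    off from the values at finitely many x by inverting a Vandermonde matrix.
    The points do not depend on p: this gives both the Cauchy estimate and the
    injectivity of evaluation. *)
Lemma coef_interpolation (m0 : 'X_{1..d}) : (0 < d)%N -> mdeg m0 = k ->
  exists n (a : 'I_n -> C) (z : 'I_n -> 'cV[C]_d), (forall t, z t != 0) /\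
    forall (p : hmap R d k) i,
      (mpoly_of_dhomog (p i))@_m0 = \sum_t a t * heval p (z t) i 0.
Proof.
move=> d0 m0k; pose code (m : 'X_{1..d}) := (\sum_j m j * k.+1 ^ j)%N.
pose n := (\sum_(j < d) k * k.+1 ^ j).+1.
have leqk (m : 'X_{1..d}) j : mdeg m = k -> (m j <= k)%N.
  by move=> <-; rewrite mdegE (bigD1 j) //= leq_addr.
have code_lt m : mdeg m = k -> (code m < n)%N.
  by move=> mk; rewrite ltnS leq_sum // => j _; rewrite leq_mul2r leqk ?orbT.
(* t.+1 rather than t keeps the points of the curve away from 0. *)
pose x : 'rV[C]_n := \row_t t.+1%:R.
have uV : Vandermonde n x \in unitmx.
  rewrite unitmxE det_Vandermonde unitfE; apply/prodf_neq0 => i _.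
  apply/prodf_neq0 => j ij; rewrite !mxE subr_eq0 eqr_nat eqSS.
  by rewrite neq_ltn ij orbT.
pose e0 := Ordinal (code_lt _ m0k).
pose a t := invmx (Vandermonde n x) t e0.
have aP e : (e < n)%N -> \sum_t a t * x 0 t ^+ e = (e == code m0)%:R.
  move=> en; have /matrixP/(_ (Ordinal en) e0) := mulmxV uV.
  rewrite !mxE => <-; apply: eq_bigr => t _.
  by rewrite !mxE mulrC.
exists n, a, (fun t => \col_j x 0 t ^+ (k.+1 ^ j)); split=> [t|p i].
  apply/eqP => /colP/(_ (Ordinal d0)); rewrite !mxE => /eqP.
  by rewrite expn0 expr1 pnatr_eq0.
set q := mpoly_of_dhomog (p i).
have qk m : m \in msupp q -> mdeg m = k by exact: (dhomog_mf (dhomog_is_dhomog (p i))).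
transitivity (\sum_(m <- msupp q) q@_m * (\sum_t a t * x 0 t ^+ code m)); last first.
  under eq_bigr do rewrite mulr_sumr; rewrite exchange_big; apply: eq_bigr => t _.
  rewrite [heval _ _ _ _]mxE mevalE mulr_sumr; apply: eq_bigr => m _.
  rewrite mulrCA; congr (_ * (_ * _)).
  rewrite /code expr_sum; apply: eq_bigr => j _.
  by rewrite !mxE mulnC exprM.
rewrite {1}[q]mpolyE raddf_sum big_seq [RHS]big_seq; apply: eq_bigr => m mq /=.
rewrite mcoeffZ mcoeffX aP ?code_lt ?qk //; congr (_ * _%:R).
congr nat_of_bool; apply/eqP/eqP => [->//|e]; apply/mnmP.
by apply: (@digits_inj k.+1) e => j; rewrite ltnS leqk // qk.
Qed.

Lemma heval_inj (p q : hmap R d k) : (0 < d)%N ->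
  (forall z, heval p z = heval q z) -> p = q.
Proof.
move=> d0 e; apply/ffunP => i; apply: val_inj; apply/mpolyP => m /=.
have [mk|mk] := eqVneq (mdeg m) k; last by rewrite !mcoeff_homog0.
have [n [a [z [_ h]]]] := coef_interpolation d0 mk.
by rewrite !h; apply: eq_bigr => t _; rewrite e.
Qed.

Lemma cauchy_estimate : (0 < d)%N -> exists2 M : R, 0 <= M &
  forall (p : hmap R d k) i m, normc (mpoly_of_dhomog (p i))@_m <= M * hnorm p.
Proof.
move=> d0.
have M1 (m : 'X_{1..d < k.+1}) : exists M : R, 0 <= M /\
    forall (p : hmap R d k) i, normc (mpoly_of_dhomog (p i))@_m <= M * hnorm p.
  have [mk|mk] := eqVneq (mdeg m) k; last first.
    by exists 0; split=> // p i; rewrite mcoeff_homog0 // normc0 mul0r.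
  have [n [a [z [z0 h]]]] := coef_interpolation d0 mk.
  exists (\sum_t normc (a t) * vnorm (z t) ^+ k); split.
    by apply: sumr_ge0 => t _; rewrite mulr_ge0 ?exprn_ge0 ?normc_ge0 ?vnorm_ge0.
  move=> p i; rewrite h mulr_suml; apply: le_trans (normc_sum _ _ _) _.
  apply: ler_sum => t _; rewrite normcM -mulrA ler_wpM2l ?normc_ge0 //.
  by rewrite mulrC; apply: le_trans (le_vnorm _ _) (hnormP _ (z0 t)).
have [M hM] := choice M1.
have S0 : 0 <= \sum_m M m by apply: sumr_ge0 => m _; have [] := hM m.
exists (\sum_m M m) => // p i m.
have [mk|mk] := eqVneq (mdeg m) k; last first.
  by rewrite mcoeff_homog0 // normc0 mulr_ge0 // hnorm_ge0.
have mb : (mdeg m < k.+1)%N by rewrite mk.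
have [_ h] := hM (BMultinom mb); apply: le_trans (h p i) _.
rewrite ler_wpM2r ?hnorm_ge0 // (bigD1 (BMultinom mb)) //= lerDl.
by apply: sumr_ge0 => m' _; have [] := hM m'.
Qed.

(** Each coefficient of p is shared equally between the words of its monomial,
    hence the bound is not lost. *)
Lemma of_coef_onto (p : hmap R d k) (B : R) :
  (forall i m, normc (mpoly_of_dhomog (p i))@_m <= B) ->
  exists2 c, p = of_coef c & forall s, normc (c s) <= B.
Proof.
move=> pB.
pose n m := #|[pred w | word_mon w == m]|.
exists (fun s => (mpoly_of_dhomog (p s.1))@_(word_mon s.2) / (n (word_mon s.2))%:R).
  apply/ffunP => i; apply: val_inj; apply/mpolyP => m /=.
  pose f (q : hmap R d k) := (mpoly_of_dhomog (q i))@_m.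
  have f0 : f 0 = 0 by rewrite /f ffunE mcoeff0.
  have fD : {morph f : q r / q + r} by move=> q r; rewrite /f ffunE /= mcoeffD.
  rewrite -/(f (of_coef _)) (big_morph f fD f0).
  have [mk|mk] := eqVneq (mdeg m) k; last first.
    rewrite mcoeff_homog0 // big1 // => -[j w] _ /=.
    by rewrite /f mcoeff_homog0.
  transitivity (\sum_(w | word_mon w == m) (mpoly_of_dhomog (p i))@_m / (n m)%:R).
    rewrite sumr_const -[RHS]mulr_natr mulfVK ?pnatr_eq0 -?lt0n //.
    by apply/card_gt0P; have [w <-] := word_mon_onto mk; exists w; rewrite inE.
  rewrite big_mkcond -(sum_state_at i); apply: eq_bigr.
  move=> [j w] _ /=; rewrite /f ffunE /= mcoeffZ mcoeff_monomap ?mdeg_word_mon // eq_sym.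
  by case: eqP => [->|_]; case: eqP => [->|_]; rewrite /= ?mulr1 ?mulr0.
move=> [i w] /=; rewrite normcM normcV; apply: le_trans (pB i (word_mon w)).
rewrite ler_piMr ?normc_ge0 //.
have -> : normc ((n (word_mon w))%:R : C) = (n (word_mon w))%:R.
  by rewrite -mulr_natr mul1r normcMn normc1.
rewrite invf_le1 ?ltr0n ?ler1n; apply/card_gt0P; exists w; exact: eqxx.
Qed.

Lemma hnorm_of_coef c : (0 < d)%N -> hnorm (of_coef c) <= \sum_s normc (c s).
Proof.
move=> d0; apply: ge_sup => [|_ [z z0 <-]].
  by case: (hnorm_has_sup (of_coef c) d0).
rewrite ler_pdivrMr ?exprn_gt0 ?vnorm_gt0 //.
have S0 : 0 <= \sum_s normc (c s) by apply: sumr_ge0 => s _; exact: normc_ge0.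
apply: vnorm_le => [|i]; first by rewrite mulr_ge0 // exprn_ge0 // vnorm_ge0.
rewrite heval_of_coef; apply: le_trans (normc_sum _ _ _) _.
apply: (@le_trans _ _ ((\sum_(w : word) normc (c (i, w))) * vnorm z ^+ k)).
  rewrite mulr_suml; apply: ler_sum => w _; rewrite normcM ler_wpM2l ?normc_ge0 //.
  rewrite normc_prod -[k in leRHS]card_ord -prodr_const; apply: ler_prod => t _.
  by rewrite normc_ge0 le_vnorm.
rewrite ler_wpM2r ?exprn_ge0 ?vnorm_ge0 //.
rewrite sum_state (bigD1 i) //= lerDl.
by apply: sumr_ge0 => j _; apply: sumr_ge0 => w _; exact: normc_ge0.
Qed.

Definition conj_entry (L : 'M[C]_d) (s s' : state) : C :=
  invmx L s.1 s'.1 * \prod_t L (s'.2 t) (s.2 t).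

Definition conj_coef (L : 'M[C]_d) (c : state -> C) (s : state) : C :=
  \sum_s' conj_entry L s s' * c s'.

Lemma conj_of_coef L c : (0 < d)%N -> conj_op L (of_coef c) = of_coef (conj_coef L c).
Proof.
move=> d0; apply: heval_inj => // z; rewrite heval_conj; apply/colP => i.
rewrite mxE heval_of_coef.
under [RHS]eq_bigr => w _ do rewrite /conj_coef sum_state mulr_suml.
rewrite exchange_big; apply: eq_bigr => j _; rewrite heval_of_coef mulr_sumr.
under [RHS]eq_bigr do rewrite mulr_suml.
rewrite exchange_big; apply: eq_bigr => v _ /=; rewrite mulrCA.
have -> : \prod_t (L *m z) (v t) 0 = \sum_(w : word) \prod_t (L (v t) (w t) * z (w t) 0).
  rewrite -(bigA_distr_bigA (fun t j => L (v t) j * z j 0)).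
  by apply: eq_bigr => t _; rewrite mxE.
rewrite !mulr_sumr; apply: eq_bigr => w _.
by rewrite big_split /= /conj_entry /=; ring.
Qed.

Lemma conj_op_mul L M (p : hmap R d k) : (0 < d)%N -> L \in unitmx -> M \in unitmx ->
  conj_op (L *m M) p = conj_op M (conj_op L p).
Proof.
move=> d0 uL uM; apply: heval_inj => // z; rewrite !heval_conj.
have -> : invmx (L *m M) = invmx M *m invmx L.
  rewrite -[LHS]mulmx1 -(mulmxV uL) -[L in X in _ *m (X *m _) = _]mulmx1.
  by rewrite -(mulmxV uM) !mulmxA -[_ *m L *m M]mulmxA mulVmx ?unitmx_mul ?uL // mul1mx.
by rewrite !mulmxA.
Qed.

(** The monomial map of state (i, w) is not strictly triangular: it involves
    some z_j with i <= j. *)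
Definition nontri (s : state) : bool := [exists t, (s.1 <= s.2 t)%N].

Lemma monomap_word_tri i w : ~~ nontri (i, w) ->
  monomap R k i (word_mon w) \in strict_tri (R:=R) (d:=d) (k:=k).
Proof.
move=> /existsPn /= tri; apply/strict_triP => i' j m ij.
rewrite mcoeff_monomap ?mdeg_word_mon //.
case: (i' =P i) ij => [-> ij|_ _]; last by rewrite eqxx.
case: (word_mon w =P m) => [<- _|_]; last by rewrite eqxx.
rewrite mnm_sumE big1 // => t _; rewrite mnm1E; case: eqP => // wt.
by have := tri t; rewrite wt ij.
Qed.

(** Dropping the coefficients at the triangular states does not change the
    class modulo strictly triangular maps. *)
Lemma qnorm_of_coef c : (0 < d)%N ->
  qnorm (\pi_(hquot R d k) (of_coef c))%qT <= \sum_(s | nontri s) normc (c s).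
Proof.
move=> d0; pose c' s := if nontri s then c s else 0.
apply: (@le_trans _ _ (hnorm (of_coef c'))).
  apply: ge_inf; first by case: (qnorm_has_inf (\pi_(hquot R d k) (of_coef c))%qT).
  exists (of_coef c') => //=; apply/eqP.
  rewrite -[_ == _]/(\pi_(hquot R d k) _ == \pi _)%qT -ring_quotient.Quotient.idealrBE.
  rewrite /of_coef -sumrB; apply: rpred_sum => -[i w] _ /=.
  rewrite -scalerBl /c'; case: ifPn => [_|tri]; first by rewrite subrr scale0r rpred0.
  exact: rpredZ (monomap_word_tri tri).
apply: le_trans (hnorm_of_coef _ d0) _; rewrite [leRHS]big_mkcond; apply: ler_sum => s _.
by rewrite /c'; case: ifP; rewrite ?normc0.
Qed.

End Words.

(** * Lower triangular conjugations *)

Section Triangular.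
Variables (R : realType) (d : nat).
Local Notation C := R[i].

Lemma entry_le_mxnorm (A : 'M[C]_d) i j : normc (A i j) <= mxnorm A.
Proof.
have := mxnormP A (delta_mx j 0); rewrite -colE => h.
have := le_trans (le_vnorm (col j A) i) h; rewrite mxE => /le_trans; apply.
rewrite ler_piMr ?mxnorm_ge0 // vnorm_le // => h'; rewrite mxE.
by case: (_ && _); rewrite ?normc1 ?normc0.
Qed.

Lemma diag_neq0 (L : 'M[C]_d) i : L \in unitmx -> is_trig_mx L -> L i i != 0.
Proof.
move=> uL tL; move: uL; rewrite unitmxE det_trig // unitfE; apply: contra => /eqP Li.
by rewrite (bigD1 i) //= Li mul0r.
Qed.

Lemma invmx_diag (L : 'M[C]_d) i : L \in unitmx -> is_trig_mx L ->
  invmx L i i = (L i i)^-1.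
Proof.
move=> uL tL; have /is_trig_mxP tM := invmx_trig uL tL.
have /matrixP/(_ i i) := mulVmx uL.
rewrite !mxE eqxx (bigD1 i) //= big1 ?addr0 => [e|h hi].
  by rewrite -[RHS]mul1r -[1]e mulfK ?diag_neq0.
case: (ltngtP i h) => [ih|ih|/val_inj e]; last by rewrite e eqxx in hi.
  by rewrite tM ?mul0r.
by move/is_trig_mxP: tL => ->; rewrite ?mulr0.
Qed.

Lemma mulmx_trig (L M : 'M[C]_d) : is_trig_mx L -> is_trig_mx M -> is_trig_mx (L *m M).
Proof.
move=> /is_trig_mxP tL /is_trig_mxP tM; apply/is_trig_mxP => i j ij.
rewrite mxE big1 // => h _; have [ih|hi] := ltnP i h; first by rewrite tL ?mul0r.
by rewrite tM ?mulr0 // (leq_ltn_trans hi).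
Qed.

Variable k : nat.
Local Notation word := {ffun 'I_k -> 'I_d}.
Local Notation state := ('I_d * word)%type.

(** The grading along which a conjugation by a lower triangular matrix is
    triangular; it takes values between 0 and (k+1)(d-1), whence the number of
    intermediate times in the theorem. *)
Definition height (s : state) : nat := (s.1 + \sum_t (d.-1 - s.2 t))%N.

Lemma height_le (s : state) : (height s <= k.+1 * d.-1)%N.
Proof.
have lt_pred (i : 'I_d) : (i <= d.-1)%N by case: (d) i => [[]|d'] // i; rewrite -ltnS.
rewrite mulSn leq_add // -[k in leqRHS]card_ord -sum_nat_const leq_sum // => t _.
exact: leq_subr.
Qed.

(** A nonzero entry needs s'.1 <= s.1 and s.2 t <= s'.2 t for all t, by
    triangularity of L and its inverse: every coordinate of the state moves in
    the direction that lowers the height and preserves nontriangularity. *)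
Lemma conj_entry_down (L : 'M[C]_d) (s s' : state) : L \in unitmx -> is_trig_mx L ->
  nontri s -> conj_entry L s s' != 0 -> s' != s -> nontri s' && (height s' < height s)%N.
Proof.
move=> uL tL; rewrite /conj_entry mulf_eq0 negb_or => ns /andP[nzi /prodf_neq0 nzw] ne.
have le1 : (s'.1 <= s.1)%N.
  by rewrite leqNgt; apply: contra nzi => lt; move/is_trig_mxP: (invmx_trig uL tL) => ->.
have le2 t : (s.2 t <= s'.2 t)%N.
  by rewrite leqNgt; apply: contra (nzw t isT) => lt; move/is_trig_mxP: tL => ->.
apply/andP; split.
  move: ns => /existsP[t st]; apply/existsP; exists t.
  exact: leq_trans le1 (leq_trans st (le2 t)).
have le2s : (\sum_t (d.-1 - s'.2 t) <= \sum_t (d.-1 - s.2 t))%N.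
  by apply: leq_sum => t _; rewrite leq_sub2l.
rewrite /height; have [e1|ne1] := eqVneq s'.1 s.1; last first.
  by rewrite -addSn leq_add // ltn_neqAle le1 andbT.
rewrite e1 ltn_add2l; have [t ht] : exists t, s'.2 t != s.2 t.
  apply/existsP; apply: contraNT ne => /existsPn h.
  rewrite [s]surjective_pairing [s']surjective_pairing e1; apply/eqP; congr pair.
  by apply/ffunP => t; apply/eqP; rewrite -[_ == _]negbK.
rewrite (bigD1 t) //= [ltnRHS](bigD1 t) //= -addSn leq_add //.
  have lt : (s.2 t < s'.2 t)%N by rewrite ltn_neqAle le2 andbT eq_sym.
  apply: ltn_sub2l => //; apply: leq_trans lt _.
  by case: (d) (s'.2 t) => [[]|d'] // i; rewrite -ltnS.
by apply: leq_sum => t' _; rewrite leq_sub2l.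
Qed.

Lemma conj_entry_le (L : 'M[C]_d) (s s' : state) x y :
  mxnorm L <= x -> mxnorm (invmx L) <= y -> normc (conj_entry L s s') <= y * x ^+ k.
Proof.
move=> Lx Ly; rewrite normcM normc_prod ler_pM ?prodr_ge0 ?normc_ge0 //.
- by move=> t _; exact: normc_ge0.
- exact: le_trans (entry_le_mxnorm _ _ _) Ly.
rewrite -[k in leRHS]card_ord -prodr_const; apply: ler_prod => t _.
by rewrite normc_ge0 (le_trans (entry_le_mxnorm _ _ _) Lx).
Qed.

(** The diagonal entry of a conjugation is a product of eigenvalues, and
    1/y <= |L i i| <= x, so it cannot be much smaller than any other entry. *)
Lemma conj_entry_diag_ge (L : 'M[C]_d) (s s' : state) x y : L \in unitmx -> is_trig_mx L ->
  mxnorm L <= x -> mxnorm (invmx L) <= y ->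
  normc (conj_entry L s s') <= (x * y) ^+ k.+1 * normc (conj_entry L s s).
Proof.
move=> uL tL Lx Ly; apply: le_trans (conj_entry_le s s' Lx Ly) _.
have x0 : 0 <= x by apply: le_trans Lx; exact: mxnorm_ge0.
have y0 : 0 <= y by apply: le_trans Ly; exact: mxnorm_ge0.
have L0 i : 0 < normc (L i i).
  rewrite lt_neqAle normc_ge0 andbT eq_sym; apply: contra (diag_neq0 i uL tL) => /eqP.
  by move/eq0_normc => ->.
have h1 i : 1 <= x * (normc (L i i))^-1.
  by rewrite ler_pdivlMr // mul1r (le_trans (entry_le_mxnorm _ _ _) Lx).
have h2 i : 1 <= y * normc (L i i).
  rewrite -ler_pdivrMr // mul1r -normcV -invmx_diag //.
  exact: le_trans (entry_le_mxnorm _ _ _) Ly.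
rewrite /conj_entry normcM normc_prod invmx_diag // normcV.
have -> : (x * y) ^+ k.+1 * ((normc (L s.1 s.1))^-1 * \prod_t normc (L (s.2 t) (s.2 t)))
    = y * x ^+ k * (x * (normc (L s.1 s.1))^-1 * \prod_t (y * normc (L (s.2 t) (s.2 t)))).
  rewrite big_split prodr_const card_ord /= exprMn !exprS.
  by move: (normc _)^-1 (\prod_(_ < _) _) => u w; ring.
rewrite ler_peMr ?mulr_ge0 ?exprn_ge0 // mulr_ege1 //.
by elim/big_rec: _ => // t z _; exact: mulr_ege1.
Qed.

(** The diagonal entry at (i, w) is the product of the lambda(w_t) divided by
    lambda(i). As the state is not triangular, some w_t is at least i; that
    factor and the denominator form one of the ratios of maxratio, and the other
    k - 1 factors are bounded by maxabs. *)
Lemma prod_diag_le (L : nat -> 'M[C]_d) (s : state) m n :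
  (forall q, (m <= q < n)%N -> (L q \in unitmx) && is_trig_mx (L q)) -> nontri s ->
  \prod_(m <= q < n) normc (conj_entry (L q) s s)
    <= maxabs (lam L n m) ^+ k.-1 * maxratio (lam L n m).
Proof.
move=> hL /existsP[t0 st0].
have -> : \prod_(m <= q < n) normc (conj_entry (L q) s s) =
    (normc (lam L n m s.1))^-1 * \prod_t normc (lam L n m (s.2 t)).
  rewrite -normc_prod -normcV -normc_prod -normcM /lam exchange_big -prodfV -big_split.
  congr normc; apply: eq_big_nat => r mrn; have /andP[uL tL] := hL r mrn.
  by rewrite /conj_entry invmx_diag.
rewrite (bigD1 t0) //= mulrA mulrC [_^-1 * _]mulrC.
apply: ler_pM; rewrite ?prodr_ge0 ?divr_ge0 ?normc_ge0 //.
- by move=> t _; exact: normc_ge0.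
- have -> : k.-1 = #|[pred t | t != t0]| by rewrite cardC1 card_ord.
  rewrite -prodr_const; apply: ler_prod => t _.
  by rewrite normc_ge0 /= /maxabs; exact: le_bigmax.
- apply: le_trans (le_bigmax _ _ s.1).
  exact: (le_bigmax_cond _ (fun j => normc (lam L n m j) / normc (lam L n m s.1))).
Qed.

Lemma prod_unit_trig (L : nat -> 'M[C]_d) (r : seq nat) :
  (forall n, n \in r -> (L n \in unitmx) && is_trig_mx (L n)) ->
  (\prod_(n <- r) L n \in unitmx) && is_trig_mx (\prod_(n <- r) L n).
Proof.
elim: r => [|n r IH] h; first by rewrite big_nil unitmx1 scalar_mx_is_trig.
have /andP[u t] := h n (mem_head _ _).
have /andP[u' t'] : (\prod_(n <- r) L n \in unitmx) && is_trig_mx (\prod_(n <- r) L n).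
  by apply: IH => n' nr; apply: h; rewrite inE nr orbT.
by rewrite big_cons -[L n * _]/(L n *m _) unitmx_mul u u' mulmx_trig.
Qed.

Lemma conj_prod_of_coef (L : nat -> 'M[C]_d) (r : seq nat) (c : state -> C) : (0 < d)%N ->
  (forall n, n \in r -> (L n \in unitmx) && is_trig_mx (L n)) ->
  conj_op (\prod_(n <- rev r) L n) (of_coef c)
    = of_coef (foldr (fun n => conj_coef (L n)) c r).
Proof.
move=> d0; elim: r => [|n r IH] h /=.
  rewrite big_nil; apply: heval_inj => // z.
  by rewrite heval_conj invmx1 !mul1mx.
have /andP[u t] := h n (mem_head _ _).
have hr n' : n' \in r -> (L n' \in unitmx) && is_trig_mx (L n').
  by move=> nr; apply: h; rewrite inE nr orbT.
have /andP[u' _] : (\prod_(n <- rev r) L n \in unitmx)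
    && is_trig_mx (\prod_(n <- rev r) L n).
  by apply: prod_unit_trig => n'; rewrite mem_rev; exact: hr.
rewrite rev_cons -cats1 big_cat /= big_seq1 -[_ * L n]/(_ *m L n).
by rewrite conj_op_mul // IH // conj_of_coef.
Qed.

End Triangular.

(** * Partitions and the norm estimate *)

Lemma chain_le_bigmax (R : realType) (N l : nat) (Phi : nat -> nat -> R) (n : nat -> nat) :
  n 0%N = 1%N -> n N.+1 = l -> (forall r, (r <= N)%N -> (n r <= n r.+1)%N) ->
  \prod_(r < N.+1) Phi (n r.+1) (n r) <=
  \big[Num.max/0]_(n : {ffun 'I_N.+2 -> 'I_l.+1} | is_partition n)
    \prod_(r < N.+1) Phi (n (inord r.+1)) (n (inord r)).
Proof.
move=> n0 nl nS.
have nle r : (r <= N.+1)%N -> (n r <= l)%N.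
  move=> rN; rewrite -nl -(subKn rN); elim: (N.+1 - r)%N (leq_subr r N.+1) => [|j IH] jN.
    by rewrite subn0.
  by apply: leq_trans (IH (ltnW jN)); rewrite -(subnSK jN) nS // subSS leq_subr.
pose n' : {ffun 'I_N.+2 -> 'I_l.+1} := [ffun r : 'I_N.+2 => inord (n r)].
have n'E r : (r <= N.+1)%N -> n' (inord r) = n r :> nat.
  by move=> rN; rewrite ffunE inordK ?inordK // ltnS nle.
have pn' : is_partition n'.
  apply/and3P; split.
  - by rewrite -[ord0]inord_val n'E //= n0.
  - by rewrite -[ord_max]inord_val n'E //= nl.
  - by apply/forallP => r; have rN := ltn_ord r; rewrite !n'E ?nS ?(ltnW rN).
apply: le_trans (le_bigmax_cond _ _ pn'); rewrite le_eqVlt; apply/orP; left; apply/eqP.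
by apply: eq_bigr => r _; rewrite !n'E // ltnW // ltnS.
Qed.

Unset Implicit Arguments.

Theorem lemma2p2 (R : realType) (d k : nat) (hd : (1 <= d)%N) (hk : (1 <= k)%N) :
  let N := (k.+1 * d.-1)%N in
  exists K : R -> R -> R,
    forall (l : nat) (L : nat -> 'M[R[i]]_d),
      (1 <= l)%N ->
      (forall n, (1 <= n <= l)%N -> (L n \in unitmx) && is_trig_mx (L n)) ->
      qopnorm (conj_quot (k := k) (\prod_(n <- rev (index_iota 1 l.+1)) L n))
      <= K (\big[Num.max/0]_(1 <= n < l.+1) mxnorm (L n))
           (\big[Num.max/0]_(1 <= n < l.+1) mxnorm (invmx (L n)))
         * l%:R ^+ N
         * \big[Num.max/0]_(n : {ffun 'I_N.+2 -> 'I_l.+1} | is_partition n)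
             \prod_(r < N.+1)
               (maxabs (lam L (n (inord r.+1)) (n (inord r))) ^+ k.-1
                * maxratio (lam L (n (inord r.+1)) (n (inord r)))).
Proof.
move=> N; have [M M0 cauchy] := cauchy_estimate R k hd.
pose q : R := #|{: 'I_d * {ffun 'I_k -> 'I_d}}|%:R.
exists (fun x y => q * (q * (y * x ^+ k * (M * 2)) * (1 + (x * y) ^+ k.+1 * q) ^+ N)).
move=> l L l1 hL; set x := \big[_/_]_(_ <= _ < _) mxnorm (L _).
set y := \big[_/_]_(_ <= _ < _) mxnorm (invmx _); set B := \big[_/_]_(_ | _) _.
have Lx n : (1 <= n <= l)%N -> mxnorm (L n) <= x.
  move=> nl; apply: (le_bigmax_seq _ _ xpredT (fun n => mxnorm (L n))) => //.
  by rewrite mem_index_iota ltnS.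
have Ly n : (1 <= n <= l)%N -> mxnorm (invmx (L n)) <= y.
  move=> nl; apply: (le_bigmax_seq _ _ xpredT (fun n => mxnorm (invmx (L n)))) => //.
  by rewrite mem_index_iota ltnS.
have l1l : (1 <= l <= l)%N by rewrite l1 leqnn.
have x0 : 0 <= x := le_trans (mxnorm_ge0 _) (Lx l l1l).
have y0 : 0 <= y := le_trans (mxnorm_ge0 _) (Ly l l1l).
have hr n : n \in index_iota 1 l.+1 -> (L n \in unitmx) && is_trig_mx (L n).
  by rewrite mem_index_iota ltnS; exact: hL.
have /andP[uP tP] : (\prod_(n <- rev (index_iota 1 l.+1)) L n \in unitmx) &&
    is_trig_mx (\prod_(n <- rev (index_iota 1 l.+1)) L n).
  by apply: prod_unit_trig => n; rewrite mem_rev; exact: hr.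
apply: ge_sup => [|_ [X X1 <-]]; first by case: (qopnorm_has_sup k hd uP tP).
(* The infimum in the quotient norm need not be attained: 2 leaves room for a
   representative p. *)
have [_ [p pX <-] hp] := inf_adherent ltr01 (qnorm_has_inf X).
have p2 : hnorm p <= 2 by apply: ltW (lt_le_trans hp _); rewrite -[2]/(1 + 1) lerD2r.
have [c pc cM] := of_coef_onto (cauchy p).
rewrite -pX conj_quot_pi // pc conj_prod_of_coef //.
(* v m holds the coefficients of the conjugate of p by L_l ... L_m. *)
pose v m := foldr (fun n => conj_coef (L n)) c (index_iota m l.+1).
apply: le_trans (qnorm_of_coef _ hd) _; rewrite -/(v 1%N).
pose T := q * (y * x ^+ k * (M * 2)).
have q0 : 0 <= q by exact: ler0n.
have T0 : 0 <= T by rewrite !mulr_ge0 // exprn_ge0.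
have C0 : 0 <= (x * y) ^+ k.+1 by rewrite exprn_ge0 // mulr_ge0.
have vE m s : (1 <= m <= l)%N -> normc (v m s) <=
    \sum_s' normc (conj_entry (L m) s s') * normc (v m.+1 s').
  move=> /andP[_ ml]; rewrite /v /index_iota subSn //=; apply: le_trans (normc_sum _ _ _) _.
  by apply: ler_sum => s' _; rewrite normcM.
have v1 s : nontri s ->
    normc (v 1%N s) <= T * (((1 + (x * y) ^+ k.+1 * q) * l%:R) ^+ N * B).
  move=> ns; rewrite -[leLHS]mul1r.
  apply: (path_bound (b := fun m s s' => normc (conj_entry (L m) s s'))
    (V := fun m s => normc (v m s)) (good := @nontri d k) (g := @height d k)
    (Phi := fun n m => maxabs (lam L n m) ^+ k.-1 * maxratio (lam L n m))) => //.
  - by move=> *; exact: normc_ge0.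
  - by move=> *; exact: normc_ge0.
  - by move=> m s' /andP[m0 ml] _; apply: vE; rewrite m0 ltnW.
  (* The intervals of a partition stop before l, so the step at time l is
     absorbed into the constant. *)
  - move=> s' _; apply: le_trans (vE _ _ l1l) _.
    rewrite /T [leRHS]mulr_natl -sumr_const; apply: ler_sum => s2 _.
    have /andP[uL tL] := hL l l1l.
    rewrite /v /index_iota subnn /= ler_pM ?normc_ge0 ?conj_entry_le ?Lx ?Ly //.
    by apply: le_trans (cM _) _; rewrite ler_wpM2l.
  - move=> m s1 s2 /andP[m0 ml] ns1 nz ne.
    have /andP[uL tL] : (L m \in unitmx) && is_trig_mx (L m) by apply: hL; rewrite m0 ltnW.
    apply: (conj_entry_down uL tL ns1 _ ne).
    by apply: contra nz => /eqP ->; rewrite normc0.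
  - move=> m s1 s2 /andP[m0 ml] ns1; have ml' : (1 <= m <= l)%N by rewrite m0 ltnW.
    have /andP[uL tL] := hL m ml'; apply: conj_entry_diag_ge => //; [exact: Lx|exact: Ly].
  - move=> m n s1 m0 /andP[mn nl] ns1; apply: prod_diag_le => // r /andP[mr rn].
    by apply: hL; rewrite (leq_trans m0 mr) (leq_trans (ltnW rn)).
  - exact: height_le.
  - move=> n n0 nl nS; rewrite mul1r.
    exact: (chain_le_bigmax
      (fun n m => maxabs (lam L n m) ^+ k.-1 * maxratio (lam L n m)) n0 nl nS).
have B0 : 0 <= B by exact: bigmax_ge_id.
have -> : q * (T * (1 + (x * y) ^+ k.+1 * q) ^+ N) * l%:R ^+ N * B
    = q * (T * (((1 + (x * y) ^+ k.+1 * q) * l%:R) ^+ N * B)).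
  by rewrite [(_ * l%:R) ^+ N]exprMn -!mulrA.
rewrite mulr_natl -sumr_const big_mkcond; apply: ler_sum => s _.
case: ifP => [|_]; first exact: v1.
by rewrite !mulr_ge0 // exprn_ge0 // mulr_ge0 // addr_ge0 // mulr_ge0.
Qed.
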